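(* Let $k$ be a non-negative integer and let $v, w$ be finite binary words with $\mathrm{len}(v) = \mathrm{len}(w) + k$, such that $v$ does not contain $w$ as a (contiguous) subword. Then $$\mathrm{Win}\left(v,w;\tfrac{1}{2}\right) < \frac{2}{1+2^k},$$ and this bound is achieved asymptotically: $\mathrm{Win}\left(0^{k+1}1^{n-1}, 1^n; \tfrac{1}{2}\right) \to \frac{2}{1+2^k}$ as $n \to \infty$.
   Context: For $p\in(0,1)$, let $\mathbb{P}_p$ denote the law of an i.i.d. sequence $X_1, X_2, \ldots$ of bits with $\mathbb{P}_p(X_i = 1) = p$, $\mathbb{P}_p(X_i=0)=1-p$. For a binary word $u = u_1\cdots u_r$, let $\tau_u = \min\{t \in \mathbb{N} : X_{t-r+1}\cdots X_t = u_1\cdots u_r\}$. Define $\mathrm{Win}(v,w;p) = \mathbb{P}_p(\tau_v < \tau_w)$. For $a\in\{0,1\}$, $a^m$ denotes the word consisting of $m$ copies of $a$, and juxtaposition denotes concatenation of words. *)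

(* Defs.v *)
From HB Require Import structures.
From mathcomp Require Import all_boot all_order all_algebra.
From mathcomp Require Import finmap.
From mathcomp Require Import all_classical all_reals all_analysis.

Set Implicit Arguments.
Unset Strict Implicit.
Unset Printing Implicit Defensive.

Import Order.TTheory GRing.Theory Num.Theory.
Import numFieldNormedType.Exports.

Local Open Scope classical_set_scope.
Local Open Scope ring_scope.

Section bit_sequences.
Context {R : realType} {d : measure_display} {T : measurableType d}.
Variable P : probability T R.

Definition mutually_independent d' (U : measurableType d')
    (X : nat -> {RV P >-> U}) : Prop :=
  forall (J : {fset nat}) (B : nat -> set U),
    (forall j, measurable (B j)) ->
    (P (\bigcap_(j in [set` J]) (X j @^-1` B j)) =
     \prod_(j <- J) P (X j @^-1` B j))%E.

(* [bernoulli_prob p] gives mass [p] to [true]; binary words are [seq bool],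
   with [true] for the bit 1 and [false] for the bit 0. *)
Definition iid_bits (p : R) (X : nat -> {RV P >-> bool}) : Prop :=
  (forall i, distribution P (X i) =1 bernoulli_prob p) /\
  mutually_independent X.

(* Bits are numbered from 0, so [X i] is the bit usually written X_{i+1}:
   the last [size u] of the first [t] bits spell [u]. *)
Definition occurs_at (X : nat -> {RV P >-> bool}) (u : seq bool) (x : T)
    (t : nat) : bool :=
  (size u <= t)%N &&
  ([seq X i x | i <- iota (t - size u) (size u)] == u).

(* The first time at which [u] has appeared, [+oo] if [u] never appears. *)
Definition tau (X : nat -> {RV P >-> bool}) (u : seq bool) (x : T) : \bar R :=
  if pselect (exists t, occurs_at X u x t) is left ex
  then ((ex_minn ex)%:R)%:E else +oo%E.

Definition Win (X : nat -> {RV P >-> bool}) (v w : seq bool) : \bar R :=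
  P [set x | (tau X v x < tau X w x)%E].

End bit_sequences.

(* Main.v *)
(* Let [p] and [q] be the probabilities that [v], respectively [w], comes first.
   Appending [v] to a random word of length [t] avoiding both words forces a
   first hit inside the appended block, where it overlaps a prefix of [v].
   Summing over [t] gives (expected waiting time) = <v,v> p + <w,v> q, with
   <u,v> the sum of 2^m over the lengths [m] of the prefixes of [v] that are
   suffixes of [u]; exchanging the words yields Conway's equation
     <v,v> p + <w,v> q = <v,w> p + <w,w> q,  p + q = 1.
   If [n = size w], then <v,v> >= 2^(n+k), <w,v> >= 0, <w,w> <= 2^(n+1) - 2 and
   <v,w> <= 2^n - 2, the last because [w] is not a suffix of [v]; therefore
   p <= 2 (1 - 2^-n) / (1 + 2^k).
   All four bounds are equalities for 0^{k+1}1^{n-1} and 1^n when [n >= 2]. *)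
Require Import Defs.
From HB Require Import structures.
From mathcomp Require Import all_boot all_order all_algebra.
From mathcomp Require Import finmap.
From mathcomp Require Import all_classical all_reals all_analysis.
From mathcomp Require Import zify ring lra.

Set Implicit Arguments.
Unset Strict Implicit.
Unset Printing Implicit Defensive.

Import Order.TTheory GRing.Theory Num.Theory.
Import numFieldNormedType.Exports.

(** * Counting words by their first hit *)

Fixpoint words n : seq (seq bool) :=
  if n is n'.+1 then [seq rcons x b | x <- words n', b <- [:: false; true]]
  else [:: [::]].

Lemma wordsS n :
  words n.+1 = [seq rcons x b | x <- words n, b <- [:: false; true]].
Proof. by []. Qed.

Lemma mem_words n x : (x \in words n) = (size x == n).
Proof.
elim: n x => [|n IHn] x; first by rewrite inE size_eq0.
rewrite wordsS.
apply/allpairsPdep/idP => [[y [b [yn _ ->]]]|].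
  by rewrite size_rcons eqSS -IHn.
case/lastP: x => // y b; rewrite size_rcons eqSS -IHn => yn.
by exists y, b; split => //; case: b.
Qed.

Lemma uniq_words n : uniq (words n).
Proof.
elim: n => // n IHn; rewrite wordsS.
apply: allpairs_uniq_dep => // -[x b] [y c] _ _ /=.
by move=> /rcons_inj[-> ->].
Qed.

Lemma sum_wordsS n (G : seq bool -> nat) :
  \sum_(z <- words n.+1) G z =
  \sum_(x <- words n) (G (rcons x false) + G (rcons x true)).
Proof.
rewrite wordsS big_allpairs_dep; apply: eq_bigr => x _.
by rewrite !big_cons big_nil /= addn0.
Qed.

Lemma sum_words_cat m n (G : seq bool -> nat) :
  \sum_(z <- words (m + n)) G z =
  \sum_(x <- words m) \sum_(y <- words n) G (x ++ y).
Proof.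
elim: n G => [|n IHn] G.
  by rewrite addn0; apply: eq_bigr => x _; rewrite big_seq1 cats0.
rewrite addnS sum_wordsS IHn; apply: eq_bigr => x _; rewrite sum_wordsS.
by apply: eq_bigr => y _; rewrite -!rcons_cat.
Qed.

Lemma infix_rconsE (T : eqType) (u x : seq T) b :
  infix u (rcons x b) = suffix u (rcons x b) || infix u x.
Proof.
by rewrite -infix_rev rev_rcons infix_consl infix_rev -rev_rcons prefix_rev.
Qed.

Lemma suffix_total (T : eqType) (u v x : seq T) :
  suffix u x -> suffix v x -> size u <= size v -> suffix u v.
Proof.
move=> /suffixP[y xE] /suffixP[z]; rewrite {}xE => yuE uv.
have := congr1 (drop (size z)) yuE; rewrite [RHS]drop_size_cat // drop_cat.
have := congr1 size yuE; rewrite !size_cat => sE.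
case: ltnP => [_ <-|zy <-]; first exact: suffix_suffix.
by rewrite (_ : size z - size y = 0) ?drop0 ?suffix_refl//; lia.
Qed.

Lemma suffix_cat_size (T : eqType) (u x z : seq T) :
  size z <= size u -> suffix u (x ++ z) -> suffix z u.
Proof. by move=> zu ux; apply: (suffix_total (suffix_suffix _ _) ux zu). Qed.

Definition avoids (v w x : seq bool) := ~~ infix v x && ~~ infix w x.

(** When neither word contains the other, this says that [v] wins the race exactly at the last
    letter of [x]. *)
Definition first_hit (v w x : seq bool) :=
  suffix v x && avoids v w (take (size x).-1 x).

Definition avoid_count v w t := \sum_(x <- words t) avoids v w x.
Definition hit_count v w t := \sum_(x <- words t) first_hit v w x.

Lemma avoidsC v w x : avoids v w x = avoids w v x.
Proof. exact: andbC. Qed.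

Lemma first_hit_rcons v w x b :
  first_hit v w (rcons x b) = suffix v (rcons x b) && avoids v w x.
Proof. by rewrite /first_hit size_rcons /= -cats1 take_size_cat. Qed.

Section infix_free_pair.
Variables (v w : seq bool) (vw : ~~ infix v w) (wv : ~~ infix w v).

(** Two words ending at the same place are nested, which the hypotheses forbid. So the race never
    ends in a tie. *)
Let suffix_excl x : suffix v x -> suffix w x -> False.
Proof.
move=> vx wx; case/orP: (leq_total (size v) (size w)) => h.
  by move/negP: vw; apply; apply/suffixW/(suffix_total vx wx).
by move/negP: wv; apply; apply/suffixW/(suffix_total wx vx).
Qed.

(** After one more letter exactly one of three things has happened: [v] was just completed, or [w]
    was, or both are still avoided. Truth values are coerced to numbers so that the identity can be
    summed over words. *)
Lemma avoids_rcons x b :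
  avoids v w x =
  first_hit v w (rcons x b) + first_hit w v (rcons x b) +
  avoids v w (rcons x b) :> nat.
Proof.
rewrite !first_hit_rcons (avoidsC w v) /avoids !infix_rconsE.
have := @suffix_excl (rcons x b).
case: (suffix v _); case: (suffix w _); case: (infix v x); case: (infix w x) => //.
all: by move=> /(_ isT isT).
Qed.

(** Telescoping of [avoids_rcons] along the letters of [y]: the race ends at one of them or survives
    them all. *)
Lemma avoids_cat x y :
  avoids v w x =
  \sum_(m < size y) (first_hit v w (x ++ take m.+1 y) +
                     first_hit w v (x ++ take m.+1 y)) +
  avoids v w (x ++ y) :> nat.
Proof.
elim/last_ind: y => [|y b IHy]; first by rewrite big_ord0 cats0.
rewrite {}IHy size_rcons big_ord_recr /=.
rewrite (@take_oversize _ (size y).+1) ?size_rcons// -rcons_cat.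
rewrite (avoids_rcons _ b) addnA; congr (_ + _ + _).
by apply: eq_bigr => m _; rewrite -cats1 !takel_cat.
Qed.

Lemma avoid_countS t :
  (avoid_count v w t).*2 =
  avoid_count v w t.+1 + hit_count v w t.+1 + hit_count w v t.+1.
Proof.
rewrite /avoid_count /hit_count !sum_wordsS -!big_split -mul2n big_distrr /=.
apply: eq_bigr => x _; have := avoids_rcons x false; have := avoids_rcons x true.
lia.
Qed.

End infix_free_pair.

(** A hit of [u] prescribes the last [n] letters, so only one [z] can contribute. *)
Lemma sum_first_hit_cat u u' x n : n <= size u ->
  \sum_(z <- words n) first_hit u u' (x ++ z) =
  first_hit u u' (x ++ drop (size u - n) u).
Proof.
move=> nu; set z0 := drop _ _.
have sz0 : size z0 = n by rewrite size_drop subKn.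
rewrite (bigD1_seq z0) ?mem_words ?sz0 ?uniq_words//= big1_seq ?addn0// => z.
rewrite mem_words => /andP[zz0 /eqP sz]; rewrite /first_hit.
case: (boolP (suffix u _)) => // ux; case/eqP: zz0.
have : suffix z u by apply: suffix_cat_size ux; rewrite sz.
by rewrite suffixE sz => /eqP.
Qed.

(** If a hit of [u] ends with the first [m.+1] letters of [v], these letters form a suffix of [u].
    Every hit of length [t + m.+1] then ends with them anyway, so fixing them loses nothing. *)
Lemma sum_first_hit_overlap u u' v t m :
  (u = v \/ ~~ infix u v) -> m.+1 <= size v ->
  \sum_(x <- words t) first_hit u u' (x ++ take m.+1 v) =
  suffix (take m.+1 v) u * hit_count u u' (t + m.+1).
Proof.
move=> uv mv; have st : size (take m.+1 v) = m.+1 by rewrite size_takel.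
rewrite /hit_count sum_words_cat.
(* A shorter [u] would lie inside the appended prefix of [v]. This contradicts [~~ infix u v], and
   for [u = v] the length bound on [m] excludes the case. *)
have [|mu] := leqP m.+1 (size u); last first.
  have us : ~~ suffix (take m.+1 v) u.
    by apply/negP => /size_suffix; rewrite st leqNgt mu.
  rewrite (negbTE us) mul0n big1 // => x _; rewrite /first_hit.
  case: (boolP (suffix u _)) => // ux.
  case: uv => [uE|/negP[]]; first by move: mu; rewrite uE; lia.
  apply: infix_trans (infix_take v m.+1).
  by apply/suffixW/(suffix_total ux); rewrite ?suffix_suffix// st ltnW.
move=> mu; case: (boolP (suffix _ _)) => [|us].
  rewrite suffixE st => /eqP tE; rewrite mul1n; apply: eq_bigr => x _.
  by rewrite sum_first_hit_cat// tE.
rewrite mul0n big1 // => x _; rewrite /first_hit.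
case: (boolP (suffix u _)) => // ux; case/negP: us.
by apply: suffix_cat_size ux; rewrite st.
Qed.

(** All of [v] is appended to each avoiding word [x]. As [x ++ v] contains [v], the survival term of
    [avoids_cat] vanishes and only the hits inside the appended block remain. *)
Lemma avoid_count_overlap v w t : ~~ infix v w -> ~~ infix w v ->
  avoid_count v w t =
  \sum_(m < size v) (suffix (take m.+1 v) v * hit_count v w (t + m.+1) +
                     suffix (take m.+1 v) w * hit_count w v (t + m.+1)).
Proof.
move=> vw wv; rewrite /avoid_count.
under eq_bigr => x _.
  rewrite (avoids_cat vw wv x v) [X in _ + X](_ : _ = 0) ?addn0; first over.
  by rewrite /avoids suffixW ?suffix_suffix.
rewrite exchange_big; apply: eq_bigr => m _; rewrite big_split /=.
by rewrite !sum_first_hit_overlap//; [right|left].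
Qed.

Lemma hit_count_small v w t : t < size v -> hit_count v w t = 0.
Proof.
move=> tv; rewrite /hit_count big1_seq// => x /andP[_].
rewrite mem_words /first_hit => /eqP xt.
by case: (boolP (suffix v x)) => // /size_suffix; rewrite xt leqNgt tv.
Qed.

Local Open Scope classical_set_scope.
Local Open Scope ring_scope.

(** * Conway's equation *)

Section conway.
Variable R : realType.

(** This is [<u,v>], twice Conway's leading number. The index [m] stands for overlap length [m.+1],
    so the empty overlap is not counted. *)
Definition correlation (u v : seq bool) : R :=
  \sum_(m < size v) (suffix (take m.+1 v) u)%:R * 2 ^+ m.+1.

(** For fair bits and words not containing each other, these are the probabilities that the race is
    undecided after [t] tosses and that [v] wins at time [t]. *)
Definition avoid_prob v w t : R := (avoid_count v w t)%:R / 2 ^+ t.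
Definition hit_prob v w t : R := (hit_count v w t)%:R / 2 ^+ t.

(** The first [m] terms are zero, since [v] cannot be completed before time [size v]; dropping them
    keeps the sum. *)
Lemma series_hit_shift v w m (p : R) : (m <= size v)%N ->
  series (hit_prob v w) @ \oo --> p ->
  (\sum_(t < n) hit_prob v w (t + m)%N) @[n --> \oo] --> p.
Proof.
move=> mv; suff -> : (fun n => \sum_(t < n) hit_prob v w (t + m)%N) =
    [sequence series (hit_prob v w) (n + m)%N]_n by rewrite cvg_shiftn.
apply/funext => n; rewrite /series /= addnC (big_cat_nat (n := m)) ?leq_addr//=.
rewrite [X in X + _]big1_seq ?add0r => [|i].
  rewrite (big_addn 0 _ m) addKn big_mkord.
  by apply: eq_bigr => i _; rewrite addnC.
rewrite mem_index_iota => /andP[_ /andP[_ im]].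
by rewrite /hit_prob hit_count_small ?mul0r//; apply: leq_trans mv.
Qed.

Variables v w : seq bool.
Hypotheses (vw : ~~ infix v w) (wv : ~~ infix w v).

Lemma avoid_prob_overlap t : avoid_prob v w t =
  \sum_(m < size v)
    ((suffix (take m.+1 v) v)%:R * 2 ^+ m.+1 * hit_prob v w (t + m.+1)%N +
     (suffix (take m.+1 v) w)%:R * 2 ^+ m.+1 * hit_prob w v (t + m.+1)%N).
Proof.
rewrite /avoid_prob avoid_count_overlap// natr_sum mulr_suml.
apply: eq_bigr => m _; rewrite /hit_prob natrD !natrM exprD.
by field; rewrite !expf_neq0.
Qed.

Lemma avoid_probS t :
  avoid_prob v w t = avoid_prob v w t.+1 + hit_prob v w t.+1 + hit_prob w v t.+1.
Proof.
rewrite /avoid_prob /hit_prob -!mulrDl -!natrD -avoid_countS// -muln2 natrM exprS.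
by field; rewrite expf_neq0.
Qed.

(** The series is the tail-sum formula for the expected waiting time. In each overlap term the
    shifted hit series has the same total as the unshifted one, so the powers of two add up to
    correlations. *)
Lemma series_avoid_prob (p q : R) :
  series (hit_prob v w) @ \oo --> p -> series (hit_prob w v) @ \oo --> q ->
  series (avoid_prob v w) @ \oo --> correlation v v * p + correlation w v * q.
Proof.
move=> hp hq.
have -> : series (avoid_prob v w) = fun n => \sum_(m < size v)
    ((suffix (take m.+1 v) v)%:R * 2 ^+ m.+1 *
       (\sum_(t < n) hit_prob v w (t + m.+1)%N) +
     (suffix (take m.+1 v) w)%:R * 2 ^+ m.+1 *
       (\sum_(t < n) hit_prob w v (t + m.+1)%N)).
  apply/funext => n; rewrite /series /= big_mkord.
  under [LHS]eq_bigr do rewrite avoid_prob_overlap.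
  rewrite exchange_big; apply: eq_bigr => m _.
  by rewrite big_split !mulr_sumr.
rewrite /correlation !mulr_suml -big_split /=.
apply: cvg_big => [|m _]; first exact: add_continuous.
apply: cvgD; first by apply: cvgMl_tmp; exact: series_hit_shift.
(* The shift needs [m.+1 <= size w], which follows if the prefix is a suffix of [w]. Otherwise the
   coefficient is zero. *)
have [us|us] := boolP (suffix (take m.+1 v) w).
  apply: cvgMl_tmp; apply: series_hit_shift hq.
  by have := size_suffix us; rewrite size_takel.
rewrite !mul0r; under eq_fun do rewrite !mul0r; exact: cvg_cst.
Qed.

(** The race ends almost surely: the avoidance probabilities form a convergent series, so they tend
    to 0, while they also equal one minus the hits so far. *)
Lemma hit_prob_total (p q : R) :
  series (hit_prob v w) @ \oo --> p -> series (hit_prob w v) @ \oo --> q ->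
  p + q = 1.
Proof.
move=> hp hq.
have v0 : v != [::] by apply: contraNneq vw => ->; rewrite infix0s.
have w0 : w != [::] by apply: contraNneq wv => ->; rewrite infix0s.
(* The partial sum at [n.+1] covers the times up to [n]. Time 0 contributes nothing because both
   words are nonempty. *)
have aS n : avoid_prob v w n =
    1 - (series (hit_prob v w) n.+1 + series (hit_prob w v) n.+1).
  elim: n => [|n IHn].
    rewrite /series /= !big_nat1 /hit_prob !hit_count_small ?lt0n ?size_eq0//.
    rewrite mul0r addr0 subr0.
    rewrite /avoid_prob /avoid_count big_seq1 /avoids !infixs0.
    by rewrite v0 w0 divr1.
  have := avoid_probS n; rewrite {}IHn !(seriesSr _ n.+1) => E.
  lra.
have a0 : avoid_prob v w @ \oo --> 0.
  by apply: cvg_series_cvg_0; apply: cvgP (series_avoid_prob hp hq).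
have a1 : avoid_prob v w @ \oo --> 1 - (p + q).
  rewrite (funext aS); apply: cvgB; first exact: cvg_cst.
  by apply: cvgD; rewrite (cvg_shiftS (series _)).
have : 0 = 1 - (p + q) by apply: cvg_unique a0 a1.
by move=> E; lra.
Qed.

End conway.

(** Avoidance is symmetric in the two words, so both sides are limits of the same series. *)
Lemma conway (R : realType) (v w : seq bool) (p q : R) :
  ~~ infix v w -> ~~ infix w v ->
  series (hit_prob R v w) @ \oo --> p -> series (hit_prob R w v) @ \oo --> q ->
  correlation R v v * p + correlation R w v * q =
  correlation R v w * p + correlation R w w * q.
Proof.
move=> vw wv hp hq; have hv := series_avoid_prob vw wv hp hq.
have hw := series_avoid_prob wv vw hq hp.
rewrite [RHS]addrC; apply: cvg_unique hv _ => //.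
rewrite (_ : avoid_prob R v w = avoid_prob R w v)//; apply/funext => t.
by congr (_%:R / _); apply: eq_bigr => x _; rewrite avoidsC.
Qed.

(** * Fair coin tosses *)

Section fair_bits.
Context {R : realType} {d : measure_display} {T : measurableType d}.
Context {P : probability T R}.
Variable X : nat -> {RV P >-> bool}.

Definition bits n x := [seq X i x | i <- iota 0 n].

Lemma size_bits n x : size (bits n x) = n.
Proof. by rewrite size_map size_iota. Qed.

Lemma bitsS n x : bits n.+1 x = rcons (bits n x) (X n x).
Proof. by rewrite /bits -addn1 iotaD map_cat cats1. Qed.

Lemma occurs_atE u x t : occurs_at X u x t = suffix u (bits t x).
Proof.
rewrite /occurs_at; have [ut|tu] /= := leqP (size u) t; last first.
  by apply/esym/negbTE/negP => /size_suffix; rewrite size_bits leqNgt tu.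
by rewrite suffixE size_bits -map_drop drop_iota subKn// add0n.
Qed.

Lemma infix_bitsP u x t :
  reflect (exists2 s, (s <= t)%N & occurs_at X u x s) (infix u (bits t x)).
Proof.
elim: t => [|t IHt].
  rewrite infixs0 -suffixs0; apply: (iffP idP) => [u0|[s]].
    by exists 0%N => //; rewrite occurs_atE.
  by rewrite leqn0 => /eqP->; rewrite occurs_atE.
rewrite bitsS infix_rconsE -bitsS -occurs_atE.
apply: (iffP orP) => [[ut|/IHt[s st us]]|[s]].
- by exists t.+1.
- by exists s => //; apply: leqW.
- rewrite leq_eqVlt => /orP[/eqP->|st us]; first by left.
  by right; apply/IHt; exists s.
Qed.

Lemma first_hit_bits v w x t : first_hit v w (bits t x) =
  occurs_at X v x t && avoids v w (bits t.-1 x).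
Proof.
rewrite /first_hit size_bits occurs_atE; case: t => [|t] //=.
by rewrite bitsS -cats1 take_size_cat// size_bits.
Qed.

Lemma tau_ltP v w x : ~~ infix v w -> ~~ infix w v ->
  (tau X v x < tau X w x)%E <-> exists t, first_hit v w (bits t x).
Proof.
move=> vw wv.
(* The words are nonempty, so occurrence times are positive and [t.-1] is really earlier than
   [t]. *)
have nocc0 u u' s : ~~ infix u u' -> occurs_at X u x s -> (0 < s)%N.
  move=> uu'; rewrite occurs_atE => /size_suffix; rewrite size_bits.
  apply: leq_trans.
  by rewrite lt0n size_eq0; apply: contraNneq uu' => ->; rewrite infix0s.
split=> [|[t]].
  rewrite /tau; case: pselect => [ev|]; last by rewrite ltNge leey.
  case: ex_minnP => t vt tmin tw; exists t; rewrite first_hit_bits vt /=.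
  have t0 := nocc0 _ _ _ vw vt.
  apply/andP; split; apply/infix_bitsP => -[s st us].
    by have := tmin _ us; lia.
  move: tw; case: pselect => [ew|[]]; last by exists s.
  case: ex_minnP => t' wt' t'min; rewrite lte_fin ltr_nat => tt'.
  by have := t'min _ us; lia.
rewrite first_hit_bits => /andP[vt /andP[_ /infix_bitsP wt]].
rewrite /tau; case: pselect => [ev|[]]; last by exists t.
case: ex_minnP => t1 _ /(_ _ vt) t1t.
case: pselect => [ew|_]; last exact: ltry.
case: ex_minnP => t2 wt2 _; rewrite lte_fin ltr_nat.
rewrite ltnNge; apply/negP => t21; apply: wt.
(* A time [t2] before [t] contradicts avoidance up to [t.-1]; otherwise [t2 = t] and both words end
   together, which is impossible. *)
have [t2t|tt2] := ltnP t2 t; first by exists t2 => //; lia.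
have t2E : t2 = t by apply/eqP; rewrite eqn_leq tt2 (leq_trans t21).
move: wt2 vt; rewrite t2E !occurs_atE => wt vt; exfalso.
have [h|h] := leqP (size v) (size w).
  by move/negP: vw; apply; exact/suffixW/(suffix_total vt wt).
by move/negP: wv; apply; exact/suffixW/(suffix_total wt vt (ltnW h)).
Qed.

Lemma first_hit_bits_inj v w x s t :
  first_hit v w (bits s x) -> first_hit v w (bits t x) -> s = t.
Proof.
wlog st : s t / (s < t)%N => [H fs ft|].
  by case: (ltngtP s t) => // h; [exact: H h fs ft|exact/esym/(H _ _ h)].
rewrite !first_hit_bits => /andP[vs _] /andP[_ /andP[/infix_bitsP[]]].
by exists s => //; lia.
Qed.

Lemma measurable_bit i (B : set bool) : measurable (X i @^-1` B).
Proof. by rewrite -[X in measurable X]setTI; exact: measurable_funPT. Qed.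

Lemma measurable_bits n (f : seq bool -> bool) : measurable [set x | f (bits n x)].
Proof.
elim: n f => [|n IHn] f.
  rewrite /bits /=; case: (f [::]).
    by rewrite (_ : mkset _ = setT) //; apply/seteqP; split.
  by rewrite (_ : mkset _ = set0) //; apply/seteqP; split.
rewrite (_ : mkset _ =
    ([set x | f (rcons (bits n x) true)] `&` X n @^-1` [set true]) `|`
    ([set x | f (rcons (bits n x) false)] `&` X n @^-1` [set false])).
  apply: measurableU; apply: measurableI; try exact: measurable_bit.
    exact: (IHn (fun u => f (rcons u true))).
  exact: (IHn (fun u => f (rcons u false))).
apply/seteqP; split=> x /=; rewrite bitsS; first by case: (X n x); [left|right].
by case=> -[? ->].
Qed.

Hypothesis hX : iid_bits (1 / 2) X.

Lemma prob_bit i b : P (X i @^-1` [set b]) = (2^-1)%:E.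
Proof.
have := hX.1 i [set b]; rewrite /distribution /pushforward /= => ->.
rewrite bernoulli_probE; last by lra.
rewrite !diracE; case: b.
  by rewrite mem_set// memNset// mule0 adde0 mule1 mul1r.
by rewrite memNset// mem_set// mule0 add0e mule1 /unstable.onem; congr _%:E; lra.
Qed.

Lemma prob_bits_eq n u : size u = n ->
  P [set x | bits n x == u] = (2 ^- n)%:E.
Proof.
move=> un.
(* Independence is applied to the first [n] indices with singletons read off [u]; the default
   [false] is never reached there. *)
have := hX.2 [fset i | i in iota 0 n]%fset (fun i => [set nth false u i])
  (fun=> I).
rewrite (_ : \bigcap_(j in _) _ = [set x | bits n x == u]).
  move=> ->.
  rewrite (eq_bigr (fun=> (2^-1)%:E)); last by move=> i _; exact: prob_bit.
  rewrite prodEFin big_const_seq count_predT iter_mulr_1 -exprVn.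
  rewrite (_ : size _ = n)//.
  rewrite -[size _]/#|` [fset i | i in iota 0 n]%fset| card_imfset//=.
  by rewrite undup_id ?iota_uniq// size_iota.
apply/seteqP; split=> x /=.
  move=> H; apply/eqP/(@eq_from_nth _ false); rewrite size_bits// => i ni.
  rewrite (nth_map 0%N) ?size_iota// nth_iota// add0n.
  by apply: (H i); rewrite /= !inE mem_iota.
move=> /eqP <- i /=; rewrite !inE mem_iota add0n => ni.
by rewrite (nth_map 0%N) ?size_iota// nth_iota.
Qed.

Lemma prob_bits n (f : seq bool -> bool) :
  P [set x | f (bits n x)] = ((\sum_(u <- words n) f u)%N%:R / 2 ^+ n)%:E.
Proof.
rewrite (_ : mkset _ =
    \bigcup_(u in [set` [seq u <- words n | f u]]) [set x | bits n x == u]).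
  rewrite measure_fin_bigcup//=.
  - rewrite -fsbig_seq ?filter_uniq ?uniq_words//= big_filter.
    rewrite natr_sum mulr_suml -sumEFin big_mkcond /= big_seq [RHS]big_seq.
    apply: eq_bigr => u; rewrite mem_words => /eqP un.
    by case: (f u); rewrite ?mul0r// mul1r prob_bits_eq.
  - by move=> u u' _ _ [x [/= /eqP <- /eqP <-]].
  - by move=> u _; exact: (measurable_bits n (pred1 u)).
apply/seteqP; split=> x /=.
  by move=> fx; exists (bits n x) => //=;
    rewrite mem_filter fx mem_words size_bits /=.
by move=> [u /=]; rewrite mem_filter => /andP[fu _] /eqP ->.
Qed.

(** The winning event is the disjoint union over [t] of the first hits at time [t], so
    sigma-additivity makes [Win] the sum of the counting probabilities. *)
Lemma Win_cvg v w : ~~ infix v w -> ~~ infix w v ->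
  exists2 p : R, Win X v w = p%:E & series (hit_prob R v w) @ \oo --> p.
Proof.
move=> vw wv; pose F t := [set x | first_hit v w (bits t x)].
have WE : Win X v w = P (\bigcup_t F t).
  rewrite /Win; congr (P _); apply/seteqP; split=> x /=.
    by move=> /(tau_ltP _ vw wv)[t ft]; exists t.
  by move=> [t _ ft]; apply/(tau_ltP _ vw wv); exists t.
have mF t : measurable (F t) by exact: measurable_bits.
have Pfin : P (\bigcup_t F t) \is a fin_num.
  by apply: fin_num_measure; exact: bigcup_measurable.
exists (fine (P (\bigcup_t F t))); first by rewrite WE fineK.
have tF : trivIset setT F.
  by move=> s t _ _ [x [fs ft]]; exact: first_hit_bits_inj fs ft.
have sF := @measure_semi_sigma_additive _ _ _ P F mF tF (bigcupT_measurable _ mF).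
have {sF} sF : \sum_(0 <= i < n) P (F i) @[n --> \oo] -->
    (fine (P (\bigcup_t F t)))%:E by rewrite fineK.
have -> : series (hit_prob R v w) = fine \o (fun n => \sum_(0 <= i < n) P (F i)).
  apply/funext => n; rewrite /= /series /=.
  by under [in RHS]eq_bigr do rewrite prob_bits; rewrite sumEFin.
exact: fine_cvg.
Qed.

End fair_bits.

(** * Values of correlations *)

Lemma suffix_nseq (T : eqType) (x : T) m n :
  (m <= n)%N -> suffix (nseq m x) (nseq n x).
Proof. by move=> mn; rewrite suffixE !size_nseq drop_nseq subKn. Qed.

Section correlation_values.
Variable R : realType.

Lemma sum_pow2 n : \sum_(m < n) 2 ^+ m.+1 = 2 ^+ n.+1 - 2 :> R.
Proof.
elim: n => [|n IHn]; first by rewrite big_ord0 expr1 subrr.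
by rewrite big_ord_recr IHn /= (exprS _ n.+1); ring.
Qed.

Lemma correlation_ge0 u v : 0 <= correlation R u v.
Proof. by apply: sumr_ge0 => m _; rewrite mulr_ge0 ?exprn_ge0 ?ler0n. Qed.

Lemma correlation_le u v : correlation R u v <= 2 ^+ (size v).+1 - 2.
Proof.
rewrite -sum_pow2; apply: ler_sum => m _.
by rewrite ler_piMl ?exprn_ge0// lern1 leq_b1.
Qed.

Lemma correlation_self_ge v : v != [::] -> 2 ^+ size v <= correlation R v v.
Proof.
rewrite -size_eq0 /correlation; case sv : (size v) => [//|n] _.
rewrite big_ord_recr /= -sv take_size suffix_refl mul1r lerDr.
by apply: sumr_ge0 => m _; rewrite mulr_ge0 ?exprn_ge0 ?ler0n.
Qed.

(** The full-length overlap would make [v] a suffix of [u]; excluding it removes the top power of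
    two. *)
Lemma correlation_le_infixN u v : ~~ infix v u ->
  correlation R u v <= 2 ^+ size v - 2.
Proof.
move=> vu; have : v != [::] by apply: contraNneq vu => ->; rewrite infix0s.
rewrite -size_eq0 /correlation; case sv : (size v) => [//|n] _.
rewrite big_ord_recr /= -sv take_size (negbTE (contraNN (@suffixW _ _ _) vu)).
rewrite mul0r addr0 sv -sum_pow2; apply: ler_sum => m _.
by rewrite ler_piMl ?exprn_ge0// lern1 leq_b1.
Qed.

Lemma correlation_ones n : correlation R (nseq n true) (nseq n true) = 2 ^+ n.+1 - 2.
Proof.
rewrite /correlation size_nseq -sum_pow2; apply: eq_bigr => m _.
by rewrite take_nseq// suffix_nseq// mul1r.
Qed.

End correlation_values.

(** The word overlaps itself only completely: a shift that still starts on a zero brings the first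
    one too early. *)
Lemma correlation_self_zeros_ones (R : realType) k n :
  let v := nseq k.+1 false ++ nseq n.+1 true in
  correlation R v v = 2 ^+ size v.
Proof.
move=> v; rewrite /correlation.
have nv j : (j < size v)%N -> nth false v j = (k < j)%N.
  rewrite /v size_cat !size_nseq nth_cat size_nseq !nth_nseq ltnS => jv.
  by case: (leqP j k) => // kj; rewrite ifT//; lia.
have sv : size v = (k.+1 + n.+1)%N by rewrite size_cat !size_nseq.
have -> : 2 ^+ size v = \sum_(m < size v) (m.+1 == size v)%:R * 2 ^+ m.+1 :> R.
  rewrite sv addnS big_ord_recr /= eqxx mul1r big1 ?add0r// => m _.
  by rewrite eqSS (ltn_eqF (ltn_ord m)) mul0r.
apply: eq_bigr => m _; congr (_%:R * _); congr nat_of_bool.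
case: eqP => [->|/eqP mv]; first by rewrite take_size suffix_refl.
apply/negbTE; rewrite suffixE size_takel//; apply/eqP => E.
have {mv} mv : (m.+1 < size v)%N by rewrite ltn_neqAle mv /=.
have Ei i : (i < m.+1)%N -> (k < size v - m.+1 + i)%N = (k < i)%N.
  move=> im; rewrite -(nv i); last by lia.
  rewrite -(nv (size v - m.+1 + i)%N); last by lia.
  by rewrite -nth_drop E nth_take.
(* Position 0 shows that the shift [size v - m.+1] is at most [k]. The next line takes the index
   whose shifted position is [k.+1], the first one; as the shift is positive, the index itself holds
   a zero. *)
have := Ei 0%N isT; rewrite addn0 ltn0 => h0.
have := Ei (k.+1 - (size v - m.+1))%N; lia.
Qed.

(** The second word has only [m] ones in all. *)
Lemma infixN_ones z m n : count id z = 0%N -> (m < n)%N ->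
  ~~ infix (nseq n true) (z ++ nseq m true).
Proof.
move=> z0 mn; apply/negP => /infixP[p [s E]].
have := congr1 (count id) E; rewrite !count_cat !count_nseq z0 /= !mul1n.
by move: mn; lia.
Qed.

Lemma correlation_zeros_ones_ones (R : realType) k n :
  correlation R (nseq k.+1 false ++ nseq n true) (nseq n.+1 true) = 2 ^+ n.+1 - 2.
Proof.
have : count id (nseq k.+1 false) = 0%N by rewrite count_nseq.
move: (nseq k.+1 false) => z z0.
rewrite /correlation size_nseq big_ord_recr take_oversize ?size_nseq//.
rewrite (negbTE (contraNN (@suffixW _ _ _) (infixN_ones z0 (ltnSn n)))).
rewrite mul0r Monoid.mulm1 -sum_pow2; apply: eq_bigr => m _.
rewrite take_nseq; last exact: ltn_ord.
by rewrite suffix_catr ?mul1r//; exact/suffix_nseq/(ltn_ord m).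
Qed.

(** Every nonempty prefix of the second word contains a zero. *)
Lemma correlation_ones_zeros (R : realType) n z :
  correlation R (nseq n true) (false :: z) = 0.
Proof.
rewrite /correlation big1 // => m _; rewrite (_ : suffix _ _ = false) ?mul0r//.
apply/negbTE/negP => /suffixW/mem_infix/(_ false); rewrite inE eqxx => /(_ isT).
by rewrite mem_nseq andbF.
Qed.

(** * The upper bound and its sharpness *)

Theorem theorem3p2 (R : realType) (d : measure_display) (T : measurableType d)
    (P : probability T R) (X : nat -> {RV P >-> bool})
    (hX : iid_bits (1 / 2) X) (k : nat) :
  (forall v w : seq bool,
     size v = (size w + k)%N -> ~~ infix w v ->
     (Win X v w < (2 / (1 + 2 ^+ k))%:E)%E) /\
  (Win X (nseq k.+1 false ++ nseq n.-1 true) (nseq n true)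
     @[n --> \oo] --> (2 / (1 + 2 ^+ k) : R)%:E).
Proof.
have K0 : 0 < 2 ^+ k :> R by rewrite exprn_gt0.
have incomparable (v w : seq bool) :
    size v = (size w + k)%N -> ~~ infix w v -> ~~ infix v w.
  move=> svw wv; apply: contra wv => vw.
  have [sv E] := size_subseq_leqif (infixW vw).
  have : size v == size w by rewrite eqn_leq sv svw leq_addr.
  by rewrite E => /eqP->; exact: infix_refl.
split=> [v w svw wv|].
  have vw := incomparable _ _ svw wv.
  have [p pE hp] := Win_cvg hX vw wv; have [q qE hq] := Win_cvg hX wv vw.
  have pq := hit_prob_total vw wv hp hq; have C := conway vw wv hp hq.
  have p0 : 0 <= p by rewrite -lee_fin -pE measure_ge0.
  have q0 : 0 <= q by rewrite -lee_fin -qE measure_ge0.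
  have v0 : v != [::] by apply: contraNneq vw => ->; rewrite infix0s.
  have := correlation_self_ge R v0; have := correlation_ge0 R w v.
  have := correlation_le R w w; have := correlation_le_infixN R wv.
  rewrite pE lte_fin ltr_pdivlMr; last lra.
  rewrite svw exprD exprS; have : 0 < 2 ^+ size w :> R by rewrite exprn_gt0.
  move: C K0; set K := 2 ^+ k; set N := 2 ^+ size w.
  move: (correlation R v v) (correlation R w v) (correlation R v w).
  move=> a b c; move: (correlation R w w) => e C K0 N0 cN eN b0 aN.
  have qE1 : q = 1 - p by lra.
  (* Inserted in Conway's equation with [q = 1 - p], the four bounds give
     [N * (1 + K) * p <= 2 * N - 2]. The [- 2] makes the final inequality strict. *)
  have h1 : N * K * p <= a * p by apply: ler_wpM2r.
  have h2 : c * p <= (N - 2) * p by apply: ler_wpM2r.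
  have h3 : e * q <= (2 * N - 2) * q by apply: ler_wpM2r.
  have h4 : 0 <= b * q by apply: mulr_ge0.
  rewrite -(ltr_pM2l N0); subst q; nra.
(* From [n = 2] on, the first word ends in at least one 1, as its self-correlation formula requires.
   There [g n] is the exact winning probability. *)
rewrite -(cvg_shiftn 2) /=.
pose g n : R := 2 / (1 + 2 ^+ k) * (1 - 2^-1 ^+ n).
rewrite (_ : (fun n => _) = (fun n => (EFin \o g) (n + 2)%N)); last first.
  apply/funext => n; rewrite addn2 /=.
  set v := nseq k.+1 false ++ nseq n.+1 true; set w := nseq n.+2 true.
  have svw : size v = (size w + k)%N by rewrite size_cat !size_nseq; lia.
  have wv : ~~ infix w v by rewrite infixN_ones// count_nseq.
  have vw := incomparable _ _ svw wv.
  have [p pE hp] := Win_cvg hX vw wv; have [q qE hq] := Win_cvg hX wv vw.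
  have pq := hit_prob_total vw wv hp hq; have := conway vw wv hp hq.
  rewrite pE /g correlation_self_zeros_ones correlation_zeros_ones_ones.
  rewrite correlation_ones correlation_ones_zeros svw exprD size_nseq.
  rewrite exprVn [2 ^+ n.+3]exprS.
  have : 0 < 2 ^+ n.+2 :> R by rewrite exprn_gt0.
  move: K0; set K := 2 ^+ k; set N := 2 ^+ n.+2 => K0 N0 C; congr _%:E.
  have {}C : N * (1 + K) * p = 2 * N - 2
    by move: C; rewrite (_ : q = 1 - p); lra.
  have NK : N * (1 + K) != 0 by rewrite mulf_neq0 ?gt_eqF//; lra.
  apply: (mulfI NK); rewrite C; field.
  by rewrite !gt_eqF//; lra.
rewrite (cvg_shiftn 2 (EFin \o g)); apply: cvg_EFin; first exact: nearW.
rewrite -[X in _ --> X]mulr1; apply: cvgMl_tmp.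
rewrite -[X in _ --> X]subr0; apply: cvgB; first exact: cvg_cst.
by apply: cvg_expr; rewrite ger0_norm; lra.
Qed.
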